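(* Let $d \ge 3$ and $k \ge 1$ be integers, let $\mathbb{F}$ be a field, and let $T:[n_1]\times\dots\times[n_d]\to\mathbb{F}$ be an order-$d$ tensor with slice rank equal to $k$. Then: 1. If $\mathbb{F}$ is finite, there exists a set $\mathcal{A}$ of $d$-tuples $(W_1,\dots,W_d)$ of linear subspaces of $\mathbb{F}^{n_1},\dots,\mathbb{F}^{n_d}$ respectively, with $|\mathcal{A}| \le d^k|\mathbb{F}|^{dk^2}$, such that whenever $r_1,\dots,r_d$ are nonnegative integers with $r_1+\dots+r_d=k$ and $a_{j,i}:[n_j]\to\mathbb{F}$ ($j\in[d]$, $i\in[r_j]$) are functions satisfying \[T(x_1,\dots,x_d)=\sum_{j=1}^d\sum_{i=1}^{r_j} a_{j,i}(x_j)\,b_{j,i}(\overline{x_j})\] for some functions $b_{j,i}:\prod_{j'\neq j}[n_{j'}]\to\mathbb{F}$, we have $(\langle a_{1,1},\dots,a_{1,r_1}\rangle,\dots,\langle a_{d,1},\dots,a_{d,r_d}\rangle)\in\mathcal{A}$. In particular, there are at most $d^k|\mathbb{F}|^{2dk^2}$ possibilities in total for $((r_1,\dots,r_d),(a_{1,1},\dots,a_{1,r_1}),\dots,(a_{d,1},\dots,a_{d,r_d}))$. 2. For any field $\mathbb{F}$, if \[T(x_1,\dots,x_d)=\sum_{j=1}^d\sum_{i=1}^{r_j}a_{j,i}(x_j)b^1_{j,i}(\overline{x_j})=\sum_{j=1}^d\sum_{i=1}^{r_j}a_{j,i}(x_j)b^2_{j,i}(\overline{x_j})\] are two slice rank decompositions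 of $T$ with the same one-variable functions $a_{j,i}$ (where for each $j$ the functions $a_{j,1},\dots,a_{j,r_j}$ are linearly independent), then the decomposition $\sum_{j=1}^d\sum_{i=1}^{r_j}a_{j,i}(x_j)(b^2_{j,i}-b^1_{j,i})(\overline{x_j})$ is in zero form.
   Context: Tensors are functions $[n_1]\times\dots\times[n_d]\to\mathbb{F}$, where $[n]=\{1,\dots,n\}$; a function $[n]\to\mathbb{F}$ is identified with a vector of $\mathbb{F}^n$. For $x=(x_1,\dots,x_d)$ and $j\in[d]$, $\overline{x_j}=(x_{j'})_{j'\neq j}$, and for $J\subset[d]$, $x(J)=(x_j)_{j\in J}$. A slice rank decomposition of $T$ is an expression $T(x)=\sum_{j=1}^d\sum_{i=1}^{r_j}a_{j,i}(x_j)b_{j,i}(\overline{x_j})$ with $a_{j,i}:[n_j]\to\mathbb{F}$, $b_{j,i}:\prod_{j'\ne j}[n_{j'}]\to\mathbb{F}$; its length is $r_1+\dots+r_d$, and the slice rank of $T$ is the minimal length of such a decomposition. Zero form: a decomposition $\sum_{j=1}^d\sum_{i=1}^{r_j}a_{j,i}(x_j)b_{j,i}(\overline{x_j})$ is in zero form if there exist functions $c_{J,j,i,i_{J\setminus\{j\}}}:\prod_{j''\in[d]\setminus J}[n_{j''}]\to\mathbb{F}$ (elements of $\mathbb{F}$ if $J=[d]$), for every $J\subset[d]$ with $2\le|J|\le d$, every $j\in J$, every $i\in[r_j]$ and every tuple $i_{J\setminus\{j\}}=(i_{j'})_{j'\in J\setminus\{j\}}\in\prod_{j'\in J\setminus\{j\}}[r_{j'}]$,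 such that (1) for every $j\in[d]$ and $i\in[r_j]$, \[b_{j,i}(\overline{x_j})=\sum_{J\subset[d]:\,j\in J,\,|J|\ge2}\ \sum_{i_{J\setminus\{j\}}}\Big(\prod_{j'\in J\setminus\{j\}}a_{j',i_{j'}}(x_{j'})\Big)c_{J,j,i,i_{J\setminus\{j\}}}(x([d]\setminus J));\] and (2) for every $J\subset[d]$ with $2\le|J|\le d$ and every $(i_{j'})_{j'\in J}\in\prod_{j'\in J}[r_{j'}]$, $\sum_{j\in J}c_{J,j,i_j,(i_{j'})_{j'\in J\setminus\{j\}}}=0$. *)

(* Defs.v *)
From HB Require Import structures.
From mathcomp Require Import all_boot all_order all_algebra.

Set Implicit Arguments.
Unset Strict Implicit.
Unset Printing Implicit Defensive.

Import GRing.Theory.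
Local Open Scope ring_scope.

Definition multiindex (d : nat) (n : 'I_d -> nat) : Type :=
  {dffun forall j : 'I_d, 'I_(n j)}.

(* Used both for the partial points x(J) (with the dimensions n) and for the
   multi-indices (i_j)_(j in J) (with the lengths r). *)
Definition submultiindex (d : nat) (n : 'I_d -> nat) (J : {set 'I_d}) : Type :=
  {dffun forall j : {j : 'I_d | j \in J}, 'I_(n (val j))}.

Definition restr (d : nat) (n : 'I_d -> nat) (J : {set 'I_d}) (x : multiindex n) :
    submultiindex n J :=
  [ffun j : {j : 'I_d | j \in J} => x (val j)].

Definition subrestr (d : nat) (n : 'I_d -> nat) (J K : {set 'I_d})
    (sKJ : K \subset J) (u : submultiindex n J) : submultiindex n K :=
  [ffun j : {j : 'I_d | j \in K} =>
     u (exist (fun j : 'I_d => j \in J) (val j)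
              (subsetP sKJ (val j) (valP j)))].

(* Functions [n_j] -> F are row vectors, so that the spans and the linear
   independence of the one-variable functions are those of vector spaces. *)
Definition is_slice_decomp (F : fieldType) (d : nat) (n : 'I_d -> nat)
    (T : multiindex n -> F) (r : 'I_d -> nat)
    (a : forall j, (r j).-tuple 'rV[F]_(n j))
    (b : forall j, 'I_(r j) -> submultiindex n [set~ j] -> F) : Prop :=
  forall x : multiindex n,
    T x = \sum_(j < d) \sum_(i < r j)
            tnth (a j) i 0 (x j) * b j i (restr [set~ j] x).

Definition has_slice_decomp (F : fieldType) (d : nat) (n : 'I_d -> nat)
    (T : multiindex n -> F) (l : nat) : Prop :=
  exists (r : 'I_d -> nat) (a : forall j, (r j).-tuple 'rV[F]_(n j))
         (b : forall j, 'I_(r j) -> submultiindex n [set~ j] -> F),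
    (\sum_(j < d) r j)%N = l /\ is_slice_decomp T a b.

Definition is_slice_rank (F : fieldType) (d : nat) (n : 'I_d -> nat)
    (T : multiindex n -> F) (k : nat) : Prop :=
  has_slice_decomp T k /\ forall l, has_slice_decomp T l -> (k <= l)%N.

(* The values of c at J with j \notin J or #|J| < 2 play no role.  For J = [d]
   the type submultiindex n (~: J) has exactly one element. *)
Definition in_zero_form (F : fieldType) (d : nat) (n : 'I_d -> nat)
    (r : 'I_d -> nat) (a : forall j, (r j).-tuple 'rV[F]_(n j))
    (b : forall j, 'I_(r j) -> submultiindex n [set~ j] -> F) : Prop :=
  exists c : forall (J : {set 'I_d}) (j : 'I_d),
      'I_(r j) -> submultiindex r (J :\ j) -> submultiindex n (~: J) -> F,
    (forall (j : 'I_d) (i : 'I_(r j)) (x : multiindex n),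
       b j i (restr [set~ j] x) =
       \sum_(J : {set 'I_d} | (j \in J) && (2 <= #|J|)%N)
         \sum_(u : submultiindex r (J :\ j))
           (\prod_(j' : {j' : 'I_d | j' \in J :\ j})
              tnth (a (val j')) (u j') 0 (x (val j')))
           * c J j i u (restr (~: J) x))
    /\
    (forall J : {set 'I_d}, (2 <= #|J|)%N ->
       forall (u : submultiindex r J) (y : submultiindex n (~: J)),
       \sum_(j : {j : 'I_d | j \in J})
         c J (val j) (u j) (subrestr (subD1set J (val j)) u) y = 0).

(* Main.v *)
(* A tensor T is written with one-variable functions spanning W = (W_1, ..., W_d)
   exactly when T is killed by every pure tensor of functionals w_1, ..., w_d
   with w_j vanishing on W_j ("W covers T").

   Counting: let U be a tuple of total dimension less than the slice rank k, so
   U does not cover T.  Successively choose covering tuples W^1, W^2, ... above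
   U of total dimension k, each meeting the sum Z of the previous ones only in U.
   A functional killing U splits into one killing Z and one killing the next W,
   so by multilinearity after d + 1 steps U would cover T.  The process thus
   stops with some Z with dim Z_j <= d k, and every covering W above U contains,
   in some coordinate j, a vector of Z_j outside U_j.  Adding such vectors one at
   a time starting from 0 gives at most (d |F|^(d k))^k covering tuples.

   Zero form: with a dual system of the a_(j,i), let P_j be the projection onto
   their span.  Expanding each b_(j,i) by 1 = P_l + (1 - P_l) in every l != j
   yields the coefficients c, and the required cancellations come from applying
   the functionals dual to the a_(j,i) for j in J and 1 - P_j for j not in J to
   the identity sum_j sum_i a_(j,i) b_(j,i) = 0. *)
Require Import Defs.
From HB Require Import structures.
From mathcomp Require Import all_boot all_order all_algebra.
From Stdlib Require Import Classical.

Set Implicit Arguments.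
Unset Strict Implicit.
Unset Printing Implicit Defensive.

Import GRing.Theory.
Local Open Scope ring_scope.

(** The ranges [K i] vary with [i]: the inner sums are moved to one tagged type, where ordinary
    distributivity applies, and the outer sum is reindexed along [fprod_of_dffun]. *)
Lemma big_distr_dffun (R : comPzSemiRingType) (I : finType) (K : I -> finType)
    (f : forall i, K i -> R) :
  \prod_i \sum_(k : K i) f i k
  = \sum_(u : {dffun forall i, K i}) \prod_i f i (u i).
Proof.
pose g i := [ffun k : K i => f i k].
transitivity (\prod_i \sum_(k : K i) g i k).
  by apply: eq_bigr => i _; apply: eq_bigr => k _; rewrite ffunE.
under eq_bigr => i _ do rewrite (big_tag (fun i => g i)).
rewrite bigA_distr_big_dep -(big_fprod 1 +%R g).
rewrite (reindex (@fprod_of_dffun I K)) /=; last first.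
  exact/onW_bij/fprod_of_dffun_bij.
by apply: eq_bigr => u _; apply: eq_bigr => i _; rewrite fprodE ffunE.
Qed.

(** * Contraction of a tensor with one functional per coordinate *)

Section Contraction.

Variables (F : fieldType) (d : nat) (n : 'I_d -> nat).
Implicit Types (T : multiindex n -> F) (w : forall j, 'cV[F]_(n j)).

(** The pure tensor of functionals evaluated on [T]; the column [w j] acts on row vectors by
    [u |-> u *m w j]. *)
Definition contract w T : F :=
  \sum_(y : multiindex n) (\prod_j w j (y j) 0) * T y.

Lemma eq_contract w w' T :
  (forall j, w j = w' j) -> contract w T = contract w' T.
Proof.
move=> e; apply: eq_bigr => y _; congr (_ * _).
by apply: eq_bigr => j _; rewrite e.
Qed.

Lemma contract_sum (I : finType) (P : pred I) w (S : I -> multiindex n -> F) :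
  contract w (fun y => \sum_(i | P i) S i y) = \sum_(i | P i) contract w (S i).
Proof.
rewrite exchange_big /=; apply: eq_bigr => y _.
by rewrite mulr_sumr.
Qed.

Lemma contractD w w' T :
  contract (fun j => w j + w' j) T =
  \sum_(J : {set 'I_d}) contract (fun j => if j \in J then w j else w' j) T.
Proof.
rewrite exchange_big /=; apply: eq_bigr => y _.
under eq_bigr => j _ do rewrite mxE.
rewrite bigA_distr mulr_suml; apply: eq_bigr => J _; congr (_ * _).
by apply: eq_bigr => j _; case: ifP.
Qed.

Lemma contract_dfwithE w j (v : 'cV[F]_(n j)) T :
  contract (dfwith w v) T = \sum_(y : multiindex n)
    v (y j) 0 * ((\prod_(l | l != j) w l (y l) 0) * T y).
Proof.
apply: eq_bigr => y _; rewrite (bigD1 j) //= dfwith_in mulrA; congr (_ * _ * _).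
by apply: eq_bigr => l jl; rewrite dfwith_out // eq_sym.
Qed.

Lemma contract_dfwith_sum (I : finType) w j (c : I -> F) (v : I -> 'cV[F]_(n j)) T :
  contract (dfwith w (\sum_i c i *: v i)) T =
  \sum_i c i * contract (dfwith w (v i)) T.
Proof.
rewrite contract_dfwithE.
under [RHS]eq_bigr => i _ do rewrite contract_dfwithE mulr_sumr.
rewrite exchange_big /=; apply: eq_bigr => y _.
rewrite summxE mulr_suml; apply: eq_bigr => i _.
by rewrite mxE -mulrA.
Qed.

Lemma contract_eq0 w j T : w j = 0 -> contract w T = 0.
Proof.
by move=> wj0; apply: big1 => y _; rewrite (bigD1 j) //= wj0 mxE !mul0r.
Qed.

Definition point_weight (x : multiindex n) (j : 'I_d) : 'cV[F]_(n j) :=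
  delta_mx (x j) 0.

Lemma contract_point (x : multiindex n) T : contract (point_weight x) T = T x.
Proof.
rewrite /contract (bigD1 x) //= [X in _ + X]big1 ?addr0; last first.
  move=> y nyx; have [j nj] : exists j, x j != y j.
    apply/existsP; apply: contraNT nyx; rewrite negb_exists => /forallP h.
    by apply/eqP/ffunP => j; have := h j; rewrite negbK => /eqP->.
  by rewrite (bigD1 j) //= mxE [y j == _]eq_sym (negbTE nj) !mul0r.
by rewrite big1 ?mul1r // => j _; rewrite mxE !eqxx.
Qed.

Definition set_coord (x : multiindex n) (j : 'I_d) (t : 'I_(n j)) : multiindex n :=
  [ffun l => dfwith x t l].

Lemma restr_set_coord x j (t : 'I_(n j)) :
  restr [set~ j] (set_coord x t) = restr [set~ j] x.
Proof.
apply/ffunP => -[l hl]; rewrite !ffunE /= dfwith_out // eq_sym.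
by move: hl; rewrite !inE.
Qed.

Lemma contract_dfwith_point x j (v : 'cV[F]_(n j)) T :
  contract (dfwith (point_weight x) v) T = \sum_t v t 0 * T (set_coord x t).
Proof.
have -> : v = \sum_t v t 0 *: delta_mx t 0.
  rewrite {1}(matrix_sum_delta v); apply: eq_bigr => t _.
  by rewrite big_ord1.
rewrite contract_dfwith_sum; apply: eq_bigr => t _; congr (_ * _).
  rewrite summxE (bigD1 t) //= !mxE !eqxx mulr1 big1 ?addr0 // => s nst.
  by rewrite !mxE eq_sym (negbTE nst) mulr0.
rewrite -contract_point; apply: eq_contract => l.
rewrite /point_weight ffunE; case: dfwithP => [|l' nl]; first by rewrite dfwith_in.
by rewrite dfwith_out.
Qed.

Lemma contract_dfwith_slice x j (v : 'cV[F]_(n j)) (a : 'rV[F]_(n j)) b :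
  contract (dfwith (point_weight x) v) (fun y => a 0 (y j) * b (restr [set~ j] y))
  = (a *m v) 0 0 * b (restr [set~ j] x).
Proof.
rewrite contract_dfwith_point mxE mulr_suml; apply: eq_bigr => t _.
by rewrite restr_set_coord ffunE dfwith_in mulrCA mulrA.
Qed.

Lemma eq_restr_set_coord (x y : multiindex n) j :
  restr [set~ j] x = restr [set~ j] y -> y = set_coord x (y j).
Proof.
move=> e; apply/ffunP => l; rewrite ffunE; case: dfwithP => // l' nl.
have hl : l' \in [set~ j] by rewrite !inE eq_sym.
by move/ffunP: e => /(_ (exist _ l' hl)); rewrite !ffunE /= => ->.
Qed.

(** Points with a common restriction off [j] form a line in direction [j]; summing along it produces
    the factor [a *m w j]. *)
Lemma contract_slice_eq0 w j (a : 'rV[F]_(n j)) b :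
  a *m w j = 0 -> contract w (fun y => a 0 (y j) * b (restr [set~ j] y)) = 0.
Proof.
move=> aw; rewrite /contract (partition_big (restr [set~ j]) xpredT) //=.
apply: big1 => z _.
have [x /eqP xz|no] := pickP (fun x : multiindex n => restr [set~ j] x == z);
  last by rewrite big_pred0.
rewrite (reindex_onto (fun t => set_coord x t) (fun y : multiindex n => y j)) /=;
  last by move=> y /eqP yz; rewrite -(@eq_restr_set_coord x y j) // yz.
transitivity (\sum_t (a 0 t * w j t 0) *
    ((\prod_(l | l != j) w l (x l) 0) * b z)).
  apply: eq_big => t.
    by rewrite restr_set_coord xz eqxx ffunE dfwith_in eqxx.
  move=> _; rewrite restr_set_coord xz (bigD1 j) //= ffunE dfwith_in.
  rewrite mulrACA [w j t 0 * _]mulrC; congr (_ * (_ * _)).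
  by apply: eq_bigr => l nl; rewrite ffunE dfwith_out // eq_sym.
rewrite -mulr_suml; move/matrixP: aw => /(_ 0 0); rewrite !mxE => ->.
by rewrite mul0r.
Qed.

(** * Covering tuples and their correspondence with slice decompositions *)

Definition annihilates j (U : {vspace 'rV[F]_(n j)}) (v : 'cV[F]_(n j)) : Prop :=
  forall u, u \in U -> u *m v = 0.

Definition covers T (U : forall j, {vspace 'rV[F]_(n j)}) : Prop :=
  forall w, (forall j, annihilates (U j) (w j)) -> contract w T = 0.

Lemma annihilates_span j r (X : r.-tuple 'rV[F]_(n j)) v :
  annihilates <<X>>%VS v <-> forall i, tnth X i *m v = 0.
Proof.
split=> [h i|h u]; first by apply: h; rewrite memv_span ?mem_tnth.
move=> /coord_span ->; rewrite mulmx_suml; apply: big1 => i _.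
by rewrite -scalemxAl -tnth_nth h scaler0.
Qed.

Lemma slice_decomp_covers T (r : 'I_d -> nat) (a : forall j, (r j).-tuple 'rV[F]_(n j))
    b : is_slice_decomp T a b -> covers T (fun j => <<a j>>%VS).
Proof.
move=> Tab w hw.
transitivity (contract w (fun y => \sum_(j < d) \sum_(i < r j)
            tnth (a j) i 0 (y j) * b j i (restr [set~ j] y))).
  by apply: eq_bigr => y _; rewrite Tab.
rewrite contract_sum; apply: big1 => j _; rewrite contract_sum; apply: big1 => i _.
by apply: contract_slice_eq0; apply: hw; rewrite memv_span ?mem_tnth.
Qed.

Lemma free_dual m r (X : r.-tuple 'rV[F]_m) : free X ->
  exists D : 'M[F]_(m, r), forall i, tnth X i *m D = delta_mx 0 i.
Proof.
(* Column [i] of [D] tabulates the linear form [coord X i] on the standard basis. *)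
move=> fX; exists (\matrix_(y, i) coord X i (delta_mx 0 y)) => i.
apply/rowP => i'; rewrite !mxE.
transitivity (coord X i' X`_i); last by rewrite coord_free // eq_sym.
rewrite -tnth_nth {2}(row_sum_delta (tnth X i)) linear_sum.
by apply: eq_bigr => y _; rewrite mxE scalarZ.
Qed.

(** The subtracted sum is evaluation at [x] after the projection onto the span of [X] defined by
    [D], and this projection fixes each [tnth X i]. *)
Lemma dual_residual m r (X : r.-tuple 'rV[F]_m) (D : 'M[F]_(m, r)) (x : 'I_m) i :
  (forall i, tnth X i *m D = delta_mx 0 i) ->
  tnth X i *m (delta_mx x 0 - \sum_l tnth X l 0 x *: col l D) = 0.
Proof.
move=> hD; rewrite mulmxBr mulmx_sumr (bigD1 i) //= big1 ?addr0; last first.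
  move=> l nl; rewrite -scalemxAr colE mulmxA hD mul_delta_mx_0 ?scaler0 //.
  by rewrite eq_sym.
rewrite -scalemxAr [col i D]colE mulmxA hD mul_delta_mx -colE.
by apply/matrixP => u v; rewrite !mxE !ord1 !eqxx mulr1 subrr.
Qed.

(** Evaluation at [x] is split as [p + q] in each coordinate and expanded over the set [J] of
    coordinates carrying [p]. The term with [J] empty vanishes because [U] covers [T]; any other
    term is a sum of slices in a chosen coordinate of [J]. *)
Lemma covers_slice_decomp T (U : forall j, {vspace 'rV[F]_(n j)}) :
  covers T U -> has_slice_decomp T (\sum_(j < d) \dim (U j)).
Proof.
move=> covU; pose a j := vbasis (U j).
have [D hD] := fin_all_exists (fun j => free_dual (basis_free (vbasisP (U j)))).
pose p (x : multiindex n) j : 'cV[F]_(n j) := \sum_i tnth (a j) i 0 (x j) *: col i (D j).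
pose q x j : 'cV[F]_(n j) := point_weight x j - p x j.
pose wt (J : {set 'I_d}) x j : 'cV[F]_(n j) := if j \in J then p x j else q x j.
pose fst (J : {set 'I_d}) := [pick j in J].
(* The weight at [j] is overwritten, so [b'] depends on [x] only off [j]; [b] reads it at any
   extension of [z], with default 0 if none exists. *)
pose b' j (i : 'I_(\dim (U j))) x :=
  \sum_(J | fst J == Some j) contract (dfwith (wt J x) (col i (D j))) T.
pose b j (i : 'I_(\dim (U j))) z :=
  if [pick x | restr [set~ j] x == z] is Some x then b' j i x else 0.
exists (fun j => \dim (U j)), a, b; split=> // x.
have bE j i : b j i (restr [set~ j] x) = b' j i x.
  rewrite /b; case: pickP => [y /eqP exy|/(_ x)]; last by rewrite eqxx.
  apply: eq_bigr => J _; apply: eq_contract => l.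
  case: dfwithP => [|l' nl]; first by rewrite dfwith_in.
  rewrite dfwith_out // /wt /q /p /point_weight (eq_restr_set_coord exy).
  by rewrite ffunE dfwith_out.
rewrite -contract_point.
transitivity (contract (fun j => p x j + q x j) T).
  by apply: eq_contract => j; rewrite addrC subrK.
rewrite contractD.
transitivity (\sum_(J : {set 'I_d}) \sum_(j | fst J == Some j)
    \sum_i tnth (a j) i 0 (x j) * contract (dfwith (wt J x) (col i (D j))) T).
  apply: eq_bigr => J _; rewrite /fst; case: pickP => [j jJ|J0].
    rewrite (big_pred1 j) => [|l]; last by rewrite /= (inj_eq Some_inj) eq_sym.
    rewrite -contract_dfwith_sum; apply: eq_contract => l.
    by case: dfwithP => //; rewrite /wt jJ.
  rewrite big_pred0 //; apply: covU => j; rewrite J0 -(span_basis (vbasisP (U j))).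
  by apply/annihilates_span => i; apply: dual_residual.
rewrite (exchange_big_dep xpredT) //=; apply: eq_bigr => j _.
rewrite exchange_big /=; apply: eq_bigr => i _.
by rewrite bE mulr_sumr.
Qed.

(** * Spaces that every covering tuple above a non-covering one must meet *)

Lemma annihilatesS j (U V : {vspace 'rV[F]_(n j)}) v :
  (U <= V)%VS -> annihilates V v -> annihilates U v.
Proof. by move=> /subvP sUV hV u /sUV /hV. Qed.

Lemma annihilates_split j (Z W : {vspace 'rV[F]_(n j)}) v :
  annihilates (Z :&: W) v ->
  exists2 v' : 'cV[F]_(n j), annihilates W (v - v') & annihilates Z v'.
Proof.
(* [v'] is [v] composed with a projection that fixes [W] and sends [Z] into [Z :&: W]. *)
move=> hv; exists (lin1_mx (addv_pi2 Z W) *m v) => u uIn.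
  by rewrite mulmxBr mulmxA mul_rV_lin1 /= addv_pi2_id // subrr.
rewrite mulmxA mul_rV_lin1 /=; apply: hv; rewrite memv_cap memv_pi2 andbT.
have uZW : u \in (Z + W)%VS by apply: (subvP (addvSl Z W)).
have -> : addv_pi2 Z W u = u - addv_pi1 Z W u.
  by rewrite -[X in X - _](addv_pi1_pi2 uZW) addrC addKr.
by rewrite rpredB ?memv_pi1.
Qed.

(** Interpolates between [Z] covering [T] ([s = 1], when [U] lies in [Z]) and [U] covering [T]
    ([s = d.+1]). *)
Definition covers_upto s T (U Z : forall j, {vspace 'rV[F]_(n j)}) : Prop :=
  forall (J : {set 'I_d}) w, (#|J| < s)%N ->
    (forall j, annihilates (U j) (w j)) ->
    (forall j, j \notin J -> annihilates (Z j) (w j)) -> contract w T = 0.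

Lemma covers_upto_add s T (U Z W : forall j, {vspace 'rV[F]_(n j)}) :
  covers T W -> (forall j, U j <= W j)%VS -> (forall j, U j <= Z j)%VS ->
  (forall j, Z j :&: W j <= U j)%VS ->
  covers_upto s T U Z -> covers_upto s.+1 T U (fun j => Z j + W j)%VS.
Proof.
move=> covW UW UZ ZWU RZ J w ltJ wU wZW.
have /fin_all_exists [v hv] j : exists v : 'cV[F]_(n j),
    [/\ annihilates (W j) (w j - v), annihilates (Z j) v & j \notin J -> v = 0].
  have [jJ|jJ] := boolP (j \in J).
    by have [v ? ?] := annihilates_split (annihilatesS (ZWU j) (wU j)); exists v.
  exists 0; split=> // [u|u _]; last by rewrite mulmx0.
  by rewrite subr0; apply: (annihilatesS _ (wZW j jJ)); rewrite addvSr.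
transitivity (contract (fun j => (w j - v j) + v j) T).
  by apply: eq_contract => j; rewrite subrK.
(* [K] is the set of coordinates using [w j - v j]. If it contains [J], all factors kill [W];
   otherwise [J :&: K] is smaller than [J] and all factors outside it kill [Z]. *)
rewrite contractD; apply: big1 => K _; have [sJK|nJK] := boolP (J \subset K).
  apply: covW => j; case: ifP => jK; first by case: (hv j).
  have [_ _ ->] := hv j; first by move=> u _; rewrite mulmx0.
  by apply: contraFN jK; apply/subsetP.
apply: (RZ (J :&: K)).
- apply: leq_trans (ltJ : (#|J| <= s)%N); apply: proper_card.
  by rewrite properE subsetIl subsetI subxx.
- move=> j; have [hW hZ _] := hv j; case: ifP => _; first exact: annihilatesS hW.
  exact: annihilatesS hZ.
move=> j; have [hW hZ h0] := hv j; case: ifP => // jK; rewrite inE jK andbT => jJ.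
by rewrite h0 // subr0; apply: (annihilatesS _ (wZW j jJ)); rewrite addvSl.
Qed.

Lemma meeting_spaces T k (U : forall j, {vspace 'rV[F]_(n j)}) : ~ covers T U ->
  exists2 Z : forall j, {vspace 'rV[F]_(n j)}, forall j, (\dim (Z j) <= d * k)%N &
    forall W : forall j, {vspace 'rV[F]_(n j)}, covers T W ->
      (forall j, \dim (W j) <= k)%N -> (forall j, U j <= W j)%VS ->
      exists j, exists2 v, v \in Z j & (v \in W j) && (v \notin U j).
Proof.
move=> ncov.
pose good (W : forall j, {vspace 'rV[F]_(n j)}) :=
  [/\ covers T W, (forall j, \dim (W j) <= k)%N & (forall j, U j <= W j)%VS].
have [[W0 [cov0 dim0 UW0]]|no] := classic (exists W, good W); last first.
  (* No admissible [W] exists above [U], so any [Z] works. *)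
  exists (fun j => 0%VS) => [j|W ? ? ?]; first by rewrite dimv0.
  by case: no; exists W.
(* [s] counts the covering tuples already summed into [Z], and [m] the additions left before [s]
   reaches [d.+1]. *)
suff build m : forall s Z, (s + m = d.+1)%N -> covers_upto s T U Z ->
    (forall j, U j <= Z j)%VS -> (forall j, \dim (Z j) <= s * k)%N ->
    exists2 Z : forall j, {vspace 'rV[F]_(n j)}, forall j, (\dim (Z j) <= d * k)%N &
    forall W, covers T W -> (forall j, \dim (W j) <= k)%N -> (forall j, U j <= W j)%VS ->
      exists j, exists2 v, v \in Z j & (v \in W j) && (v \notin U j).
  apply: (build d 1%N W0) => // [J w|j]; last by rewrite mul1n.
  rewrite ltnS leqn0 cards_eq0 => /eqP -> _ h; apply: cov0 => j.
  by apply: h; rewrite inE.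
elim: m => [|m IH] s Z sm RZ UZ dimZ.
  (* At [s = d.+1] the exceptional set may be all of [[d]], so [U] would cover [T]. *)
  case: ncov => w wU; apply: (RZ [set: 'I_d]) => // [|j]; last by rewrite inE.
  by rewrite cardsT card_ord -sm addn0.
have [[W [[covW dimW UW] ZWU]]|no] :=
    classic (exists W, good W /\ forall j, (Z j :&: W j <= U j)%VS).
  apply: (IH s.+1 (fun j => Z j + W j)%VS).
  - by rewrite addSnnS.
  - exact: covers_upto_add.
  - by move=> j; apply: subv_trans (UZ j) (addvSl _ _).
  - move=> j; rewrite mulSn addnC.
    by apply: leq_trans (dimv_add_leqif _ _) (leq_add _ _).
(* The process is stuck; at least one addition was left, so [s <= d]. *)
exists Z => [j|W covW dimW UW].
  apply: leq_trans (dimZ j) (leq_mul _ _) => //.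
  by move: sm; rewrite addnS => -[<-]; rewrite leq_addr.
have /existsP [j /subvPn [v]] : [exists j, ~~ (Z j :&: W j <= U j)%VS].
  apply: contraT; rewrite negb_exists => /forallP h; case: no; exists W.
  by split=> // j; have := h j; rewrite negbK.
by rewrite memv_cap => /andP[vZ vW] vU; exists j, v; rewrite ?vW.
Qed.

End Contraction.

(** * Decompositions of the zero tensor are in zero form *)

Section ZeroForm.

Variables (F : fieldType) (d : nat) (n : 'I_d -> nat).
Implicit Types (T : multiindex n -> F) (w : forall j, 'cV[F]_(n j)).

(** Overrides [w] on [J]; matching on [idP] supplies the membership proof that indexes [v]. *)
Definition extend (J : {set 'I_d}) (v : forall s : {j | j \in J}, 'cV[F]_(n (val s)))
    w (j : 'I_d) : 'cV[F]_(n j) :=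
  match @idP (j \in J) with
  | ReflectT h => v (exist _ j h)
  | ReflectF _ => w j
  end.

Lemma extend_in (J : {set 'I_d}) (v : forall s : {j | j \in J}, 'cV[F]_(n (val s))) w j
    (h : j \in J) : extend v w j = v (exist _ j h).
Proof.
by rewrite /extend; case: {-}_ / idP => [h'|//]; rewrite (bool_irrelevance h' h).
Qed.

Lemma extend_out (J : {set 'I_d}) (v : forall s : {j | j \in J}, 'cV[F]_(n (val s))) w j :
  j \notin J -> extend v w j = w j.
Proof. by rewrite /extend => /negP nJ; case: {-}_ / idP. Qed.

Lemma contract_extendE (J : {set 'I_d})
    (v : forall s : {j | j \in J}, 'cV[F]_(n (val s))) w T :
  contract (extend v w) T = \sum_(y : multiindex n)
    (\prod_s v s (y (val s)) 0) * ((\prod_(l | l \notin J) w l (y l) 0) * T y).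
Proof.
apply: eq_bigr => y _; rewrite (bigID (mem J)) /= mulrA; congr (_ * _ * _).
  by rewrite big_sub; apply: eq_bigr => -[j jJ] _; rewrite extend_in.
by apply: eq_bigr => j jJ; rewrite extend_out.
Qed.

(** Multilinearity in all coordinates of [J] at once; it produces the multi-indices of the zero
    form. *)
Lemma contract_extend_sum (J : {set 'I_d}) (r : 'I_d -> nat)
    (c : forall s : {j | j \in J}, 'I_(r (val s)) -> F)
    (v : forall s : {j | j \in J}, 'I_(r (val s)) -> 'cV[F]_(n (val s))) w T :
  contract (extend (fun s => \sum_i c s i *: v s i) w) T =
  \sum_(u : submultiindex r J)
    (\prod_s c s (u s)) * contract (extend (fun s => v s (u s)) w) T.
Proof.
rewrite contract_extendE.
under [RHS]eq_bigr => u _ do rewrite contract_extendE mulr_sumr.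
rewrite exchange_big /=; apply: eq_bigr => y _.
under [RHS]eq_bigr => u _ do rewrite mulrA -big_split.
rewrite -mulr_suml; congr (_ * _).
rewrite -(big_distr_dffun (fun s i => c s i * v s i (y (val s)) 0)).
apply: eq_bigr => s _; rewrite summxE; apply: eq_bigr => i _.
by rewrite mxE.
Qed.

Lemma null_decomp_zero_form (r : 'I_d -> nat) (a : forall j, (r j).-tuple 'rV[F]_(n j))
    (b : forall j, 'I_(r j) -> submultiindex n [set~ j] -> F) :
  (forall j, free (a j)) -> is_slice_decomp (fun=> 0) a b -> in_zero_form a b.
Proof.
move=> fa null.
have [D hD] := fin_all_exists (fun j => free_dual (fa j)).
pose p j (t : 'I_(n j)) : 'cV[F]_(n j) := \sum_i tnth (a j) i 0 t *: col i (D j).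
pose q j (t : 'I_(n j)) : 'cV[F]_(n j) := delta_mx t 0 - p j t.
pose S j (y : multiindex n) := \sum_i tnth (a j) i 0 (y j) * b j i (restr [set~ j] y).
have S0 w j : (forall i, tnth (a j) i *m w j = 0) -> contract w (S j) = 0.
  move=> aw; rewrite contract_sum; apply: big1 => i _.
  exact: contract_slice_eq0.
have aq j t i : tnth (a j) i *m q j t = 0 by apply: dual_residual.
have sumS w : \sum_j contract w (S j) = 0.
  rewrite -contract_sum; apply: big1 => y _.
  by rewrite -(null y) mulr0.
(* The value 0 on [J] is a placeholder, overwritten below when [j] lies in [J]. *)
pose rest J (z : submultiindex n (~: J)) : forall j, 'cV[F]_(n j) :=
  extend (fun s : {j | j \in ~: J} => q (val s) (z s)) (fun=> 0).
exists (fun J j i u z => contract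
  (extend (fun s : {l | l \in J :\ j} => col (u s) (D (val s)))
    (dfwith (rest J z) (col i (D j)))) (S j)).
split=> [j i x|J _ u z].
  (* The functional dual to [a_(j,i)] in coordinate [j] extracts [b j i] from [S j]. *)
  transitivity (contract (dfwith (point_weight F x) (col i (D j))) (S j)).
    rewrite contract_sum (bigD1 i) //= big1 ?addr0 => [|l nl];
      rewrite (contract_dfwith_slice _ _ _ (b j _)) colE mulmxA hD.
      by rewrite mul_delta_mx mxE !eqxx mul1r.
    by rewrite mul_delta_mx_0 // mxE mul0r.
  (* Coordinate [j] is split as the dual functional plus 0, so only sets containing [j] survive. *)
  transitivity (contract (fun l => dfwith (fun l => p l (x l)) (col i (D j)) l +
      dfwith (fun l => q l (x l)) (0 : 'cV[F]_(n j)) l) (S j)).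
    apply: eq_contract => l; case: dfwithP => [|l' nl].
      by rewrite !dfwith_in addr0.
    by rewrite !dfwith_out // addrC subrK.
  rewrite contractD (bigID (fun J : {set 'I_d} => (j \in J) && (2 <= #|J|)%N)) /=.
  rewrite [X in _ + X]big1 ?addr0 => [|J]; last first.
    rewrite negb_and -leqNgt => jJ2; have [jJ|jJ] := boolP (j \in J); last first.
      by apply: (@contract_eq0 _ _ _ _ j); rewrite (negbTE jJ) dfwith_in.
    have {jJ2} J1 : J = [set j].
      apply/eqP; rewrite eq_sym eqEcard sub1set jJ cards1.
      by move: jJ2; rewrite jJ.
    (* For [J = [set j]] every other [S l] meets [q] in coordinate [l] and vanishes; by [sumS] so
       does [S j]. *)
    set w := (X in contract X _); have := sumS w.
    rewrite (bigD1 j) //= [X in _ + X]big1 ?addr0 // => l nl.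
    apply: S0 => i'; rewrite /w J1 inE (negbTE nl) dfwith_out //.
    by rewrite eq_sym.
  apply: eq_bigr => J /andP[jJ _].
  rewrite -(contract_extend_sum
    (fun s : {l | l \in J :\ j} => fun i' => tnth (a (val s)) i' 0 (x (val s)))
    (fun s : {l | l \in J :\ j} => fun i' => col i' (D (val s)))).
  apply: eq_contract => l; have [lj|nlj] := eqVneq l j.
    by subst l; rewrite extend_out ?jJ ?dfwith_in // !inE eqxx.
  have njl : j != l by rewrite eq_sym.
  have [lJ|lJ] := boolP (l \in J).
    have lJj : l \in J :\ j by rewrite !inE nlj.
    by rewrite (extend_in _ _ lJj) dfwith_out.
  have lCJ : l \in ~: J by rewrite inE.
  rewrite extend_out ?dfwith_out // ?inE ?(negbTE lJ) ?andbF //.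
  by rewrite /rest (extend_in _ _ lCJ) ffunE.
(* For a full multi-index [u] on [J], the weights defining the coefficients are this same [w] for
   every [j] in [J]. *)
pose w := extend (fun s : {l | l \in J} => col (u s) (D (val s))) (rest J z).
transitivity (\sum_(s : {j | j \in J}) contract w (S (val s))).
  apply: eq_bigr => -[j jJ] _ /=; apply: eq_contract => l.
  have [lj|nlj] := eqVneq l j.
    by subst l; rewrite extend_out ?dfwith_in /w ?(extend_in _ _ jJ) // !inE eqxx.
  have njl : j != l by rewrite eq_sym.
  have [lJ|lJ] := boolP (l \in J).
    have lJj : l \in J :\ j by rewrite !inE nlj.
    rewrite (extend_in _ _ lJj) /w (extend_in _ _ lJ) ffunE /=.
    by rewrite (bool_irrelevance (subsetP _ _ _) lJ).
  rewrite extend_out ?dfwith_out // /w ?extend_out //.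
  by rewrite !inE (negbTE lJ) andbF.
have <- : \sum_(j in J) contract w (S j) =
    \sum_(s : {j | j \in J}) contract w (S (val s)).
  exact: big_sub.
have := sumS w; rewrite (bigID (fun j => j \in J)) /= [X in _ + X]big1 ?addr0 // => l lJ.
have lCJ : l \in ~: J by rewrite inE.
by apply: S0 => i; rewrite /w extend_out // /rest (extend_in _ _ lCJ).
Qed.

End ZeroForm.

(** * Enumerating functions and vectors over a finite field *)

Lemma enum_ffun_axiom (K : choiceType) (e : seq K) (I : finType) : Finite.axiom e ->
  exists2 s : seq {ffun I -> K}, size s = (size e ^ #|I|)%N & forall f, f \in s.
Proof.
move=> he; have me x : x \in e by rewrite -has_pred1 has_count he.
have ue : uniq e by apply: count_mem_uniq => x; rewrite he me.
exists [seq [ffun i => ssval (g i)] | g : {ffun I -> seq_sub e}].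
  by rewrite size_map -cardE card_ffun card_seq_sub.
move=> f; apply/mapP; exists [ffun i => SeqSub (me (f i))]; first by rewrite mem_enum.
by apply/ffunP => i; rewrite !ffunE.
Qed.

Lemma vbasis_coords (F : fieldType) (V : vectType F) (Z : {vspace V}) N v :
  (\dim Z <= N)%N -> v \in Z ->
  exists c : {ffun 'I_N -> F}, v = \sum_(i < N) c i *: (vbasis Z)`_i.
Proof.
(* Coordinates are padded with zeros up to length [N]. *)
move=> dimZ vZ; pose g m := if insub m is Some i then coord (vbasis Z) i v else 0.
exists [ffun i : 'I_N => g i]; under eq_bigr => i _ do rewrite ffunE.
rewrite {1}(coord_vbasis vZ).
transitivity (\sum_(i < \dim Z) g i *: (vbasis Z)`_i).
  by apply: eq_bigr => i _; rewrite /g valK.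
rewrite (big_ord_widen _ (fun i => g i *: (vbasis Z)`_i) dimZ) big_mkcond.
apply: eq_bigr => i _; case: ltnP => // dimi.
by rewrite nth_default ?scaler0 ?size_tuple.
Qed.

Lemma enum_vspace (F : fieldType) (e : seq F) (V : vectType F) (Z : {vspace V}) N :
  Finite.axiom e -> (\dim Z <= N)%N ->
  exists s : seq V, size s = (size e ^ N)%N /\ {subset Z <= s}.
Proof.
move=> he dimZ; have [s0 sz s0P] := enum_ffun_axiom 'I_N he.
exists [seq \sum_(i < N) f i *: (vbasis Z)`_i | f : {ffun 'I_N -> F} <- s0].
split; first by rewrite size_map sz card_ord.
move=> v /(vbasis_coords dimZ) [c ->].
by apply: (map_f (fun f : {ffun 'I_N -> F} => \sum_(i < N) f i *: (vbasis Z)`_i)).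
Qed.

Lemma cover_seq_union (X Y : eqType) (s : seq X) (Q : X -> Y -> Prop) N :
  (forall x, exists2 A : seq Y, (size A <= N)%N & forall y, Q x y -> y \in A) ->
  exists2 A : seq Y, (size A <= size s * N)%N &
    forall x y, x \in s -> Q x y -> y \in A.
Proof.
move=> h; elim: s => [|x s [A szA hA]]; first by exists [::].
have [B szB hB] := h x; exists (B ++ A).
  by rewrite size_cat mulSn leq_add.
move=> x' y; rewrite inE mem_cat => /predU1P[->|x's] Qxy; first by rewrite hB.
by rewrite (hA x') ?orbT.
Qed.

(** * Counting covering tuples and minimal decompositions *)

Section FiniteField.

Variables (F : fieldType) (d : nat) (n : 'I_d -> nat) (T : multiindex n -> F).
Variables (e : seq F) (k : nat).
Hypothesis he : Finite.axiom e.
Hypothesis rank_ge : forall l, has_slice_decomp T l -> (k <= l)%N.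

Let tuples := {dffun forall j : 'I_d, {vspace 'rV[F]_(n j)}}.

(** Induction on the missing dimension [m]. Below dimension [k] the tuple [U] does not cover, so [W]
    contains a new vector from a space [Z j]: [d] choices of [j] and at most [size e ^ (d * k)] of
    the vector. Adjoining it to [U j] lowers [m] by one. *)
Lemma covering_extensions m (U : tuples) : (\sum_(j < d) \dim (U j) + m = k)%N ->
  exists2 A : seq tuples, (size A <= (d * size e ^ (d * k)) ^ m)%N &
    forall W : tuples, covers T W -> (\sum_(j < d) \dim (W j) = k)%N ->
      (forall j, U j <= W j)%VS -> W \in A.
Proof.
elim: m U => [|m IH] U dimU.
  (* With no dimension missing, inclusion in each coordinate and equal total dimension force
     [W = U]. *)
  exists [:: U] => // W _ dimW UW; rewrite inE eq_sym; apply/eqP/ffunP => j.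
  apply/eqP; rewrite -(dimv_leqif_eq (UW j)).
  have /leqifP : (\sum_(j < d) \dim (U j) <= \sum_(j < d) \dim (W j)
                   ?= iff [forall j, \dim (U j) == \dim (W j)])%N.
    by apply: leqif_sum => l _; split=> //; apply: dimvS.
  by case: forallP => [h _|_]; [apply/h | rewrite dimW -dimU addn0 ltnn].
have ncov : ~ covers T U.
  move=> /covers_slice_decomp /rank_ge; rewrite -dimU addnS ltnNge.
  by rewrite leq_addr.
have [Z dimZ hZ] := meeting_spaces k ncov.
have [s hs] := fin_all_exists (fun j => enum_vspace he (dimZ j)).
pose Q j v (W : tuples) := [/\ covers T W, (\sum_(j < d) \dim (W j) = k)%N,
  (forall j, U j <= W j)%VS & (v \in W j) && (v \notin U j)].
have [|A szA hA] := @cover_seq_union 'I_d tuples (enum 'I_d)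
    (fun j W => exists2 v, v \in s j & Q j v W)
    (size e ^ (d * k) * (d * size e ^ (d * k)) ^ m)%N.
  move=> j; have [|B szB hB] := @cover_seq_union _ tuples (s j) (Q j)
      ((d * size e ^ (d * k)) ^ m)%N.
    move=> v; have [vU|vU] := boolP (v \in U j).
      by exists [::] => // W [_ _ _]; rewrite vU andbF.
    pose U' : tuples := [ffun l => dfwith U (U j + <[v]>)%VS l].
    have [|A szA hA] := IH U'.
      rewrite -dimU (bigD1 j) //= [in RHS](bigD1 j) //= ffunE dfwith_in.
      rewrite dimv_disjoint_sum; last first.
        apply/eqP; rewrite -subv0; apply/subvP => u; rewrite memv_cap => /andP[uU].
        move=> /vlineP [c uE]; rewrite memv0 uE scaler_eq0; apply: contraT.
        rewrite negb_or => /andP[c0 _]; case/negP: vU.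
        by rewrite -(scalerK c0 v) -uE memvZ.
      rewrite dim_vline; have -> : v != 0 by apply: contraNneq vU => ->; rewrite mem0v.
      rewrite (eq_bigr (fun l => \dim (U l))) => [|l nl].
        by rewrite addn1 !addSn addnS.
      by rewrite ffunE dfwith_out // eq_sym.
    exists A => // W [covW dimW UW /andP[vW _]]; apply: hA => // l.
    rewrite ffunE; case: dfwithP => // .
    by rewrite subv_add UW -memvE.
  have [sz _] := hs j; rewrite sz in szB; exists B => //.
  by move=> W [v vs QW]; apply: hB QW.
exists A.
  by rewrite expnS -mulnA; move: szA; rewrite size_enum_ord.
move=> W covW dimW UW; have [|j [v vZ vW]] := hZ W covW _ UW.
  by move=> j; rewrite -dimW (bigD1 j) //= leq_addr.
apply: (hA j); first by rewrite mem_enum.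
by exists v => //; case: (hs j) => _; apply.
Qed.

Lemma covering_tuples :
  exists2 A : seq tuples, (size A <= d ^ k * size e ^ (d * k ^ 2))%N &
    forall W : tuples, covers T W -> (\sum_(j < d) \dim (W j) = k)%N -> W \in A.
Proof.
have [|A szA hA] := @covering_extensions k [ffun j => 0%VS].
  by rewrite big1 ?add0n // => j _; rewrite ffunE dimv0.
exists A; first by move: szA; rewrite expnMn -expnM -mulnA -mulnn.
by move=> W covW dimW; apply: hA => // j; rewrite ffunE sub0v.
Qed.

(** The spans cover [T], so their dimensions sum to at least [k], while each is at most [r j];
    equality holds throughout. *)
Lemma minimal_decomp_dim (r : 'I_d -> nat) (a : forall j, (r j).-tuple 'rV[F]_(n j)) b :
  (\sum_(j < d) r j)%N = k -> is_slice_decomp T a b ->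
  forall j, \dim <<a j>> = r j.
Proof.
move=> sr /slice_decomp_covers/covers_slice_decomp/rank_ge kle j.
have /leqifP : (\sum_(j < d) \dim <<a j>> <= \sum_(j < d) r j
                 ?= iff [forall j, \dim <<a j>> == r j])%N.
  apply: leqif_sum => l _; split=> //.
  by apply: leq_trans (dim_span _) _; rewrite size_tuple.
by case: forallP => [h _|_]; [apply/eqP/h | rewrite sr ltnNge kle].
Qed.

Lemma minimal_decomp_spans :
  exists A : seq tuples, [/\ uniq A, (size A <= d ^ k * size e ^ (d * k ^ 2))%N &
    forall (r : {ffun 'I_d -> nat})
           (a : {dffun forall j : 'I_d, (r j).-tuple 'rV[F]_(n j)}),
      (\sum_(j < d) r j)%N = k -> (exists b, is_slice_decomp T a b) ->
      [ffun j : 'I_d => <<a j>>%VS] \in A].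
Proof.
have [A szA hA] := covering_tuples; exists (undup A); split.
- exact: undup_uniq.
- exact: leq_trans (size_undup A) szA.
have subA (W : tuples) : W \in A -> W \in undup A by rewrite mem_undup.
move=> r a sr [b Tab].
apply: subA; apply: hA.
  move=> w hw; apply: (slice_decomp_covers Tab) => j.
  by have := hw j; rewrite ffunE.
rewrite -sr; apply: eq_bigr => j _; rewrite ffunE.
exact: minimal_decomp_dim Tab j.
Qed.

(** The spans determine [r] by their dimensions, and each vector has at most [k] coordinates in a
    basis of its span, so [d * k * k] scalars encode the rest. *)
Lemma minimal_decomp_vectors : (0 < k)%N ->
  exists S : seq {r : {ffun 'I_d -> nat} &
                  {dffun forall j : 'I_d, (r j).-tuple 'rV[F]_(n j)}},
    [/\ uniq S, (size S <= d ^ k * size e ^ (2 * d * k ^ 2))%N &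
    forall (r : {ffun 'I_d -> nat})
           (a : {dffun forall j : 'I_d, (r j).-tuple 'rV[F]_(n j)}),
      (\sum_(j < d) r j)%N = k -> (exists b, is_slice_decomp T a b) ->
      existT _ r a \in S].
Proof.
(* Writing [k] as a successor lets [inord] take values in ['I_k'.+1]. *)
case: k rank_ge minimal_decomp_spans minimal_decomp_dim => // k' _ [A [_ szA hA]] hdim _.
have [C szC hC] := enum_ffun_axiom ('I_d * 'I_k'.+1 * 'I_k'.+1)%type he.
pose dec (r : {ffun 'I_d -> nat}) (W : tuples)
    (c : {ffun 'I_d * 'I_k'.+1 * 'I_k'.+1 -> F}) :
    {r : {ffun 'I_d -> nat} & {dffun forall j : 'I_d, (r j).-tuple 'rV[F]_(n j)}} :=
  existT (fun r : {ffun 'I_d -> nat} =>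
    {dffun forall j : 'I_d, (r j).-tuple 'rV[F]_(n j)})
  r [ffun j => [tuple \sum_(l < k'.+1) c (j, inord i, l) *: (vbasis (W j))`_l | i < r j]].
pose dims (W : tuples) : {ffun 'I_d -> nat} := [ffun j => \dim (W j)].
pose S := allpairs (fun W => dec (dims W) W) A C.
exists (undup S); split; first exact: undup_uniq.
  apply: leq_trans (size_undup S) _; rewrite size_allpairs szC.
  rewrite !card_prod !card_ord.
  have -> : (2 * d * k'.+1 ^ 2 = d * k'.+1 ^ 2 + d * k'.+1 * k'.+1)%N.
    by rewrite -mulnA mul2n -addnn -mulnn !mulnA.
  by rewrite expnD mulnA leq_mul2r szA orbT.
move=> r a sr Tab; rewrite mem_undup.
have [b Tb] := Tab; have dima := hdim r a b sr Tb.
pose W : tuples := [ffun j => <<a j>>%VS].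
have rW : dims W = r by apply/ffunP => j; rewrite !ffunE dima.
have rk j : (\dim (W j) <= k'.+1)%N by rewrite ffunE dima -sr (bigD1 j) //= leq_addr.
have aW j i : tnth (a j) i \in W j by rewrite ffunE memv_span ?mem_tnth.
have [f hf] := fin_all_exists (fun j =>
  fin_all_exists (fun i => vbasis_coords (rk j) (aW j i))).
(* Rows with index at least [r j] are filled with 0. *)
pose c : {ffun 'I_d * 'I_k'.+1 * 'I_k'.+1 -> F} :=
  [ffun t => if insub (nat_of_ord t.1.2) is Some i then f t.1.1 i t.2 else 0].
suff -> : existT _ r a = dec (dims W) W c.
  by apply: allpairs_f => //; apply: hA.
rewrite rW /dec; congr existT; apply/ffunP => j; rewrite ffunE; apply: eq_from_tnth => i.
rewrite tnth_mktuple hf; apply: eq_bigr => l _; congr (_ *: _).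
rewrite ffunE /= inordK ?valK //.
by apply: leq_trans (ltn_ord i) _; rewrite -dima; have := rk j; rewrite ffunE.
Qed.

End FiniteField.

Theorem theorem3p5 (d k : nat) (hd : (3 <= d)%N) (hk : (1 <= k)%N)
    (F : fieldType) (n : 'I_d -> nat) (T : multiindex n -> F)
    (hT : is_slice_rank T k) :
  (forall enumF : seq F, Finite.axiom enumF ->
     (exists A : seq {dffun forall j : 'I_d, {vspace 'rV[F]_(n j)}},
        [/\ uniq A,
            (size A <= d ^ k * size enumF ^ (d * k ^ 2))%N &
            forall (r : {ffun 'I_d -> nat})
                   (a : {dffun forall j : 'I_d, (r j).-tuple 'rV[F]_(n j)}),
              (\sum_(j < d) r j)%N = k ->
              (exists b, is_slice_decomp T a b) ->
              [ffun j : 'I_d => <<a j>>%VS] \in A])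
     /\
     (exists S : seq {r : {ffun 'I_d -> nat} &
                      {dffun forall j : 'I_d, (r j).-tuple 'rV[F]_(n j)}},
        [/\ uniq S,
            (size S <= d ^ k * size enumF ^ (2 * d * k ^ 2))%N &
            forall (r : {ffun 'I_d -> nat})
                   (a : {dffun forall j : 'I_d, (r j).-tuple 'rV[F]_(n j)}),
              (\sum_(j < d) r j)%N = k ->
              (exists b, is_slice_decomp T a b) ->
              existT _ r a \in S]))
  /\
  (forall (r : 'I_d -> nat) (a : forall j, (r j).-tuple 'rV[F]_(n j))
          (b1 b2 : forall j, 'I_(r j) -> submultiindex n [set~ j] -> F),
     (forall j, free (a j)) ->
     is_slice_decomp T a b1 -> is_slice_decomp T a b2 ->
     in_zero_form a (fun j i y => b2 j i y - b1 j i y)).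
Proof.
have [_ rank_ge] := hT; split=> [e he|r a b1 b2 fa dec1 dec2].
  split; first exact: minimal_decomp_spans.
  exact: minimal_decomp_vectors.
(* The difference of the two decompositions represents [T - T = 0]. *)
apply: null_decomp_zero_form => // x.
under eq_bigr => j _ do under eq_bigr => i _ do rewrite mulrBr.
under eq_bigr => j _ do rewrite sumrB.
by rewrite sumrB -dec1 -dec2 subrr.
Qed.
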